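(* Every regular incline is commutative; that is, if $R$ is an incline in which every element is regular, then $ab=ba$ for all $a,b\in R$.
   Context: A semiring is a nonempty set $R$ with two operations $+$ and $\cdot$ such that $(R,+)$ is a commutative semigroup, $(R,\cdot)$ is a semigroup (not necessarily commutative), and multiplication distributes over addition from either side; no zero or identity element is assumed. An incline is a semiring $R$ that is additively idempotent ($a+a=a$ for all $a\in R$) and satisfies $x+xy=x+yx=x$ for all $x,y\in R$. An element $a$ of a semiring $R$ is regular if $axa=a$ for some $x\in R$; $R$ is regular if every element of $R$ is regular. A semiring $R$ is commutative if $ab=ba$ for all $a,b\in R$. *)

(* Defs.v *)
From mathcomp Require Import ssreflect ssrfun ssrbool.

Set Implicit Arguments.
Unset Strict Implicit.
Unset Printing Implicit Defensive.

(* MathComp's semiring structures all have a zero and a one, and its additive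
   semigroups require a choiceType carrier, so none of them covers semirings
   on an arbitrary nonempty carrier without distinguished elements. *)
Structure semiring := Semiring {
  carrier :> Type;
  sadd : carrier -> carrier -> carrier;
  smul : carrier -> carrier -> carrier;
  semiring_nonempty : inhabited carrier;
  saddA : associative sadd;
  saddC : commutative sadd;
  smulA : associative smul;
  smulDl : left_distributive smul sadd;
  smulDr : right_distributive smul sadd
}.

Declare Scope semiring_scope.
Delimit Scope semiring_scope with SR.
Bind Scope semiring_scope with carrier.
Notation "x + y" := (sadd x y) : semiring_scope.
Notation "x * y" := (smul x y) : semiring_scope.
Local Open Scope semiring_scope.

Record is_incline (R : semiring) : Prop := IsIncline {
  incline_addxx : idempotent_op (@sadd R);
  incline_absorbr : forall x y : R, x + x * y = x;
  incline_absorbl : forall x y : R, x + y * x = x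
}.

Definition regular_element (R : semiring) (a : R) : Prop :=
  exists x : R, a * x * a = a.

Definition regular_semiring (R : semiring) : Prop :=
  forall a : R, regular_element a.

Definition commutative_semiring (R : semiring) : Prop :=
  forall a b : R, a * b = b * a.

(* Main.v *)
(* Order an incline by x <= y iff y + x = y, so that products lie below their
   factors.  If a = axa, then ax <= a gives a = (ax)a <= aa <= a, so a is
   idempotent.  Hence ab = abab = a(ba)b <= ba, and by symmetry ba <= ab. *)
Require Import Defs.
From mathcomp Require Import ssreflect ssrfun ssrbool.

Local Open Scope semiring_scope.

Lemma incline_regular_idem (R : semiring) (incR : is_incline R) (a : R) :
  regular_element a -> a * a = a.
Proof.
case: incR => _ absr _ [x axa].
(* Both sides equal [a + a * a]: absorption gives [a], while [a = a * x * a] and distributivity turn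
   it into [(a * x + a) * a], where [a] absorbs [a * x]. *)
by rewrite -[RHS](absr a a) -[X in _ = X + _]axa -smulDl saddC absr.
Qed.

(** Absorption twice: [y] may be replaced by [y + x * y], and the new term [x * y] absorbs
    [x * y * z]. *)
Lemma incline_absorb_inner (R : semiring) (incR : is_incline R) (x y z : R) :
  y + x * y * z = y.
Proof.
case: incR => _ absr absl.
by rewrite -[X in X + _](absl y x) -saddA absr absl.
Qed.

Theorem corollary3p3 (R : semiring) (incR : is_incline R)
  (regR : regular_semiring R) : commutative_semiring R.
Proof.
have idem (c : R) : c * c = c by apply: incline_regular_idem.
have le (a b : R) : b * a + a * b = b * a.
  by rewrite -[a * b]idem smulA -(smulA a b a) incline_absorb_inner.
(* Antisymmetry: by [le] in both directions, each product equals the sum of the two. *)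
by move=> a b; rewrite -[LHS]le saddC le.
Qed.
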